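(* Let $X$ be a nonzero strictly convex real Banach space. Then $X$ satisfies (N1), i.e. every convex combination of slices of $B_X$ is relatively norm open in $B_X$, but $X$ fails (CS), i.e. there is a convex combination of slices of $B_X$ which does not intersect $S_X$.
   Context: All Banach spaces are real. $B_X$ and $S_X$ denote the closed unit ball and the unit sphere of $X$, and $X^*$ is the topological dual. $X$ is strictly convex if every point of $S_X$ is an extreme point of $B_X$. A slice of $B_X$ is a set $S(B_X,f,\alpha):=\{x\in B_X: f(x)>1-\alpha\}$ with $f\in S_{X^*}$ and $\alpha>0$. A convex combination of slices of $B_X$ is a set $\sum_{i=1}^n\lambda_i S_i$ (Minkowski sum), where $\lambda_1,\dots,\lambda_n\in[0,1]$, $\sum_{i=1}^n\lambda_i=1$, and each $S_i$ is a slice of $B_X$. *)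

(* Defs.v *)
From HB Require Import structures.
From mathcomp Require Import all_boot all_order all_algebra.
From mathcomp Require Import all_classical all_reals all_analysis.
Set Implicit Arguments.
Unset Strict Implicit.
Unset Printing Implicit Defensive.
Import Order.TTheory GRing.Theory Num.Theory.
Import numFieldNormedType.Exports.
Local Open Scope classical_set_scope.
Local Open Scope ring_scope.

Definition unit_ball (R : realType) (X : normedModType R) : set X :=
  [set x | `|x| <= 1].

Definition unit_sphere (R : realType) (X : normedModType R) : set X :=
  [set x | `|x| = 1].

Arguments unit_ball {R} X _.
Arguments unit_sphere {R} X _.

Definition extreme_point (R : realType) (X : lmodType R) (A : set X) (x : X) :=
  A x /\ forall (y z : X) (t : R), A y -> A z -> 0 < t -> t < 1 ->
    x = t *: y + (1 - t) *: z -> y = x /\ z = x.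

Definition strictly_convex (R : realType) (X : normedModType R) :=
  forall x : X, unit_sphere X x -> extreme_point (unit_ball X) x.

(* Meaningful for continuous f only: [sup] is 0 on an unbounded set. *)
Definition dual_norm (R : realType) (X : normedModType R)
    (f : {linear X -> R^o}) : R :=
  sup [set `|f x| | x in unit_ball X].

(* The topological dual X^* is the set of continuous f : {linear X -> R^o}. *)
Definition dual_sphere (R : realType) (X : normedModType R) :
    set {linear X -> R^o} :=
  [set f : {linear X -> R^o} | continuous (f : X -> R^o) /\ dual_norm f = 1].

Arguments dual_sphere {R} X _.

Definition slice (R : realType) (X : normedModType R)
    (f : {linear X -> R^o}) (alpha : R) : set X :=
  [set x | unit_ball X x /\ 1 - alpha < f x].

Definition is_slice (R : realType) (X : normedModType R) (S : set X) :=
  exists (f : {linear X -> R^o}) (alpha : R),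
    [/\ dual_sphere X f, 0 < alpha & S = slice f alpha].

(* The Minkowski sum of the dilates [lambda i *: S i]. *)
Definition minkowski_comb (R : realType) (X : lmodType R) (n : nat)
    (lambda : 'I_n -> R) (S : 'I_n -> set X) : set X :=
  [set y | exists x : 'I_n -> X,
    (forall i, S i (x i)) /\ y = \sum_(i < n) lambda i *: x i].

Definition convex_comb_of_slices (R : realType) (X : normedModType R)
    (C : set X) :=
  exists (n : nat) (lambda : 'I_n -> R) (S : 'I_n -> set X),
    [/\ forall i, 0 <= lambda i <= 1,
        \sum_(i < n) lambda i = 1,
        forall i, is_slice (S i) &
        C = minkowski_comb lambda S].

Definition relatively_open (T : topologicalType) (B C : set T) :=
  exists2 U : set T, open U & C = U `&` B.

Definition property_N1 (R : realType) (X : normedModType R) :=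
  forall C : set X, convex_comb_of_slices C -> relatively_open (unit_ball X) C.

Definition property_CS (R : realType) (X : normedModType R) :=
  forall C : set X, convex_comb_of_slices C -> C `&` unit_sphere X !=set0.

Lemma not_property_CS (R : realType) (X : normedModType R) :
  ~ property_CS X <->
  exists2 C : set X, convex_comb_of_slices C & C `&` unit_sphere X = set0.
Proof.
split=> [/existsNP[C /not_implyP[CC /set0P/negP]]|[C CC C0] /(_ C CC)].
  by rewrite negbK => /eqP C0; exists C.
by rewrite C0 => -[].
Qed.

(* Main.v *)
Require Import Defs.
From HB Require Import structures.
From mathcomp Require Import all_boot all_order all_algebra.
From mathcomp Require Import all_classical all_reals all_analysis.
From mathcomp Require Import lra.
Import Order.TTheory GRing.Theory Num.Theory.
Import numFieldNormedType.Exports.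
Local Open Scope classical_set_scope.
Local Open Scope ring_scope.

(** Openness of convex combinations of slices.  Let [z = sum_i l_i x_i] with
    [x_i] in the slice [S_i].  If every [x_i] of positive weight equals [z],
    then [z] lies in all the slices that matter; these are relatively open, so
    every [y] of the ball close to [z] lies in all of them too, and
    [y = sum_i l_i y].  Otherwise some [x_k] of positive weight differs from
    [z].  Replacing every [x_i] by [(1 - t) x_i + t z] does not change the
    combination, stays in the slices for small [t > 0], and by strict convexity
    brings the [k]-th point into the open ball ([minkowski_comb_shrink]).  From
    there that one point can absorb any small displacement of [z]
    ([minkowski_comb_near]).

    Failure of (CS).  For [f] in the dual sphere, [S(f, 1)] and [S(- f, 1)] are
    the parts of the ball where [f > 0] and where [f < 0].  A point of the
    sphere that is the midpoint of a point of each would, being extreme, be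
    equal to both of them.

    The dual sphere of a nonzero space is not empty by the Hahn-Banach theorem.
    It is proved here by minimality among sublinear functionals rather than by
    extending linear forms: Zorn's lemma gives a minimal sublinear functional
    below a given one ([minimal_sublinear]), and a minimal sublinear functional
    is linear ([minimal_sublinear_linear]). *)

(** * Sublinear functionals and the Hahn-Banach theorem *)

(** Homogeneity is asked in the form of an inequality for [c > 0] only, which
    is what infima preserve directly; applied to [c] and to its inverse it gives
    the equality for [c >= 0] ([sublinearZ]). *)
Definition sublinear {R : realType} {X : lmodType R} (p : X -> R) :=
  (forall x y, p (x + y) <= p x + p y) /\
  (forall c x, 0 < c -> p (c *: x) <= c * p x).

Section HahnBanach.
Set Implicit Arguments.
Unset Strict Implicit.
Context (R : realType) (X : lmodType R).
Implicit Types (p q r : X -> R) (x y : X).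

Lemma sublinear0 p : sublinear p -> p 0 = 0.
Proof.
move=> [pD pZ]; have p0 := pD 0 0; have := pZ 2^-1 0.
rewrite scaler0 addr0 in p0 *.
have h : 0 < 2^-1 :> R by rewrite invr_gt0.
move=> /(_ h) p1; apply/eqP; rewrite eq_le -(lerDl (p 0)) p0 andbT.
by move: p1; rewrite ler_pdivlMl// mulr_natl mulr2n gerDl.
Qed.

Lemma sublinearZ p c x : sublinear p -> 0 <= c -> p (c *: x) = c * p x.
Proof.
move=> sp; rewrite le_eqVlt => /predU1P[<-|c0].
  by rewrite scale0r mul0r sublinear0.
have pZ := sp.2; apply/eqP; rewrite eq_le pZ//=.
have ci0 : 0 < c^-1 by rewrite invr_gt0.
have := pZ c^-1 (c *: x) ci0.
by rewrite scalerA mulVf ?gt_eqF// scale1r ler_pdivlMl.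
Qed.

(** The lower bound that makes infima of sublinear functionals finite. *)
Lemma sublinear_ge p x : sublinear p -> - p (- x) <= p x.
Proof.
by move=> sp; rewrite lerNl -subr_ge0 opprK -(sublinear0 sp) -(addNr x) sp.1.
Qed.

(** Common to the two infima used below: over a chain, where the [k] of the
    hypotheses is the smaller of [g] and [h], or [g] itself, and over the family
    [tilts], where it is obtained by adding or rescaling the parameters. *)
Lemma inf_sublinear (A : set (X -> R)) :
  A !=set0 -> (forall x, has_lbound [set g x | g in A]) ->
  (forall g h x y, A g -> A h -> exists2 k, A k & k (x + y) <= g x + h y) ->
  (forall g c x, A g -> 0 < c -> exists2 k, A k & k (c *: x) <= c * g x) ->
  sublinear (fun x => inf [set g x | g in A]).
Proof.
move=> [g0 Ag0] Alb AD AZ.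
have ne x : [set g x | g in A] !=set0 by exists (g0 x), g0.
split=> [x y|c x c0].
  rewrite -inf_sumE; [|by split..].
  apply: lb_le_inf.
    by exists (g0 x + g0 y), (g0 x); [exists g0 | exists (g0 y) => //; exists g0].
  move=> _ [_ [g Ag <-] [_ [h Ah <-] <-]].
  have [k Ak] := AD g h x y Ag Ah; apply: le_trans.
  by apply: ge_inf => //; exists k.
rewrite -ler_pdivrMl//; apply: lb_le_inf => // _ [g Ag <-].
have [k Ak kg] := AZ g c x Ag c0.
rewrite ler_pdivrMl//; apply: le_trans kg.
by apply: ge_inf => //; exists k.
Qed.

(** The lower bound [- p (- x)] is the same for all sublinear functionals below
    [p], so a chain of them has a pointwise infimum, which is sublinear. *)
Lemma minimal_sublinear p : sublinear p ->
  exists q, [/\ sublinear q, forall x, q x <= p x &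
    forall r, sublinear r -> (forall x, r x <= q x) -> forall x, q x <= r x].
Proof.
move=> sp; pose P q := sublinear q /\ forall x, q x <= p x.
pose below (u v : {q | P q}) := `[< forall x, sval v x <= sval u x >].
pose p' : {q | P q} := exist P p (conj sp (fun=> lexx _)).
have [| | |[q [sq qp]] qmin] := @ZL_preorder {q | P q} p' below.
- by move=> u; apply/asboolP.
- move=> u v w /asboolP uv /asboolP vw; apply/asboolP => x.
  exact: le_trans (vw x) (uv x).
- move=> A totA; have [->|/set0P[u0 Au0]] := eqVneq A set0; first by exists p'.
  pose B := [set sval u | u in A].
  have Blb x : has_lbound [set g x | g in B].
    exists (- p (- x)) => _ [_ [[g [sg gp]] _ <-] <-] /=.
    by apply: le_trans (sublinear_ge x sg); rewrite lerN2.
  have sB : sublinear (fun x => inf [set g x | g in B]).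
    apply: inf_sublinear => //.
    - by exists (sval u0), u0.
    - move=> _ _ x y [u Au <-] [v Av <-].
      have [/asboolP uv|/asboolP vu] := totA _ _ Au Av.
        exists (sval v); first by exists v.
        by rewrite (le_trans ((svalP v).1.1 x y))// lerD2r.
      exists (sval u); first by exists u.
      by rewrite (le_trans ((svalP u).1.1 x y))// lerD2l.
    - move=> _ c x [u Au <-] c0; exists (sval u); first by exists u.
      exact: (svalP u).1.2.
  have infB u x : A u -> inf [set g x | g in B] <= sval u x.
    by move=> Au; apply: ge_inf => //; exists (sval u) => //; exists u.
  have Bp x : inf [set g x | g in B] <= p x.
    exact: le_trans (infB u0 x Au0) ((svalP u0).2 x).
  exists (exist P _ (conj sB Bp)) => u Au; apply/asboolP => x /=.
  exact: infB.
exists q; split=> // r sr rq.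
have rp x : r x <= p x by exact: le_trans (rq x) (qp x).
by have /asboolP := qmin (exist P r (conj sr rp)) (introT (asboolP _) rq).
Qed.

(** As [p (x + t y) <= p x + t p y], each member is at most [p x]; the infimum
    [tilt p y] is the largest sublinear functional below [p] whose value at
    [- y] is at most [- p y], that is, which is linear along [y]. *)
Definition tilts p y : set (X -> R) :=
  [set (fun x => p (x + t *: y) - t * p y) | t in [set t : R | 0 <= t]].

Definition tilt p y x := inf [set g x | g in tilts p y].

Lemma tilt_lbound p x y : sublinear p -> has_lbound [set g x | g in tilts p y].
Proof.
move=> sp; exists (- p (- x)) => _ [_ [t /= t0 <-] <-].
rewrite lerBrDr addrC lerBlDr -sublinearZ//.
by have := sp.1 (x + t *: y) (- x); rewrite addrAC subrr add0r.
Qed.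

Lemma tilt_le p y x t : sublinear p -> 0 <= t ->
  tilt p y x <= p (x + t *: y) - t * p y.
Proof.
move=> sp t0; apply: ge_inf; first exact: tilt_lbound.
by exists (fun u => p (u + t *: y) - t * p y) => //; exists t.
Qed.

Lemma tilt_sublinear p y : sublinear p -> sublinear (tilt p y).
Proof.
move=> sp; apply: inf_sublinear.
- by exists (fun x => p (x + 0 *: y) - 0 * p y); exists 0 => /=.
- by move=> x; exact: tilt_lbound.
- move=> _ _ x z [s /= s0 <-] [t /= t0 <-].
  exists (fun x => p (x + (s + t) *: y) - (s + t) * p y).
    by exists (s + t) => //=; rewrite addr_ge0.
  by rewrite scalerDl mulrDl opprD [x + z + _]addrACA [leRHS]addrACA lerD2r sp.1.
- move=> _ c x [t /= t0 <-] c0.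
  exists (fun x => p (x + (c * t) *: y) - (c * t) * p y).
    by exists (c * t) => //=; rewrite mulr_ge0// ltW.
  by rewrite -scalerA -scalerDr -mulrA mulrBr lerD2r sp.2.
Qed.

(** Minimality forces [q <= tilt q y]; the member of the tilted family of
    parameter [t = 1] then gives [q x <= q (x + y) - q y], which together with
    subadditivity is additivity. *)
Lemma minimal_sublinear_linear q : sublinear q ->
  (forall r, sublinear r -> (forall x, r x <= q x) -> forall x, q x <= r x) ->
  linear (q : X -> R^o).
Proof.
move=> sq qmin.
have qD x y : q (x + y) = q x + q y.
  apply/eqP; rewrite eq_le sq.1/= -lerBrDr.
  have tq z : tilt q y z <= q z.
    by have := tilt_le y z sq (lexx 0); rewrite scale0r addr0 mul0r subr0.
  apply: le_trans (qmin _ (tilt_sublinear y sq) tq x) _.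
  by have := tilt_le y x sq ler01; rewrite scale1r mul1r.
have qN x : q (- x) = - q x.
  by apply/eqP; rewrite -addr_eq0 -qD addNr sublinear0.
move=> c x y; rewrite qD; congr (_ + _).
have [c0|/ltW c0] := leP 0 c; first by rewrite sublinearZ.
by rewrite -[c]opprK scaleNr qN sublinearZ ?oppr_ge0// scaleNr.
Qed.

(** A minimal functional below [tilt p x0], rather than below [p] itself, is
    at most [- p x0] at [- x0], so being linear it takes the value [p x0] at
    [x0]. *)
Lemma Hahn_Banach p x0 : sublinear p ->
  exists f : {linear X -> R^o}, (forall x, f x <= p x) /\ f x0 = p x0.
Proof.
move=> sp.
have [q [sq qp qmin]] := minimal_sublinear (tilt_sublinear x0 sp).
have qlin := minimal_sublinear_linear sq qmin.
pose f : {linear X -> R^o} := HB.pack (q : X -> R^o)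
  (GRing.isLinear.Build R X R^o _ (q : X -> R^o) qlin).
have fp x : f x <= p x.
  have := tilt_le x0 x sp (lexx 0); rewrite scale0r addr0 mul0r subr0.
  exact: le_trans (qp x).
exists f; split=> //; apply/eqP; rewrite eq_le fp/= -lerN2.
have := tilt_le x0 (- x0) sp ler01.
rewrite scale1r addNr sublinear0// sub0r mul1r; apply: le_trans.
by rewrite -[X in X <= _](linearN f) qp.
Qed.

End HahnBanach.

(** * Norm-one functionals *)

Section DualSphere.
Set Implicit Arguments.
Unset Strict Implicit.
Context (R : realType) (X : normedModType R).

Lemma norm_sublinear : sublinear (fun x : X => `|x|).
Proof.
split=> [x y|c x c0]; first exact: ler_normD.
by rewrite normrZ gtr0_norm.
Qed.

Lemma dual_sphere_neq0 : (exists x : X, x != 0) -> dual_sphere X !=set0.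
Proof.
move=> [x0 x0_neq0].
have [f [fle fx0]] := Hahn_Banach x0 norm_sublinear.
have fn x : `|f x| <= `|x|.
  by rewrite ler_norml fle andbT lerNl -linearN -[leRHS]normrN fle.
exists f; split.
  apply/linear_bounded_continuous/linear_boundedP; exists 1; split=> // r r1 x.
  by apply: le_trans (fn x) _; rewrite -[leLHS]mul1r ler_wpM2r// ltW.
rewrite /dual_norm; apply/eqP; rewrite eq_le; apply/andP; split.
  apply: ge_sup; first by exists `|f 0|, 0 => //; rewrite /unit_ball/= normr0.
  by move=> _ [x xB <-]; apply: le_trans (fn x) xB.
have nx0 : `| `|x0|^-1 *: x0 | = 1.
  by rewrite normrZ normfV normr_id mulVf ?normr_eq0.
apply: ub_le_sup.
  by exists 1 => _ [x xB <-]; apply: le_trans (fn x) xB.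
exists (`|x0|^-1 *: x0); first by rewrite /unit_ball/= nx0.
by rewrite linearZ/= fx0 /GRing.scale/= mulVf ?normr_eq0// normr1.
Qed.

Lemma dual_sphereN (f : {linear X -> R^o}) :
  dual_sphere X f -> dual_sphere X (\- f).
Proof.
move=> [fc f1]; split; first by move=> x; apply: cvgN; exact: fc.
rewrite -f1 /dual_norm; congr sup; apply/seteqP.
by split=> _ [x xB <-]; exists x => //=; rewrite normrN.
Qed.

End DualSphere.

(** * Slices of the ball of a strictly convex space *)

Section Slices.
Set Implicit Arguments.
Unset Strict Implicit.
Context (R : realType) (X : normedModType R).
Implicit Types (x y z : X) (S C : set X).

Lemma is_slice_near S x : is_slice S -> S x ->
  \forall y \near x, unit_ball X y -> S y.
Proof.
move=> [f [a [[fc _] _ ->]]] [_ fx].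
have fgt : \forall y \near x, 1 - a < f y by exact: (cvgr_gt (f x) (fc x)).
by apply: filterS fgt => y fy yB; split.
Qed.

Lemma is_slice_sub_ball S : is_slice S -> S `<=` unit_ball X.
Proof. by move=> [f [a [_ _ ->]]] x []. Qed.

Lemma unit_ball_segment x y (t : R) : unit_ball X x -> unit_ball X y ->
  0 < t < 1 -> unit_ball X (t *: x + (1 - t) *: y).
Proof.
move=> xB yB /andP[t0 t1]; rewrite /unit_ball/= (le_trans (ler_normD _ _))//.
rewrite !normrZ !gtr0_norm ?subr_gt0// -[leRHS](subrKC t) lerD//.
  by rewrite ger_pMr//; exact: xB.
by rewrite ger_pMr ?subr_gt0//; exact: yB.
Qed.

Lemma unit_ball_comb n (l : 'I_n -> R) (x : 'I_n -> X) :
  (forall i, 0 <= l i) -> \sum_(i < n) l i = 1 ->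
  (forall i, unit_ball X (x i)) -> unit_ball X (\sum_(i < n) l i *: x i).
Proof.
move=> l0 l1 xB; rewrite /unit_ball/= (le_trans (ler_norm_sum _ _ _))// -l1.
apply: ler_sum => i _; rewrite normrZ ger0_norm//.
by rewrite -[leRHS]mulr1 ler_wpM2l//; exact: xB.
Qed.

Lemma near_relatively_open (B C : set X) : C `<=` B ->
  (forall x, C x -> \forall y \near x, B y -> C y) -> relatively_open B C.
Proof.
move=> CB Cnear; exists (interior (C `|` ~` B)); first exact: open_interior.
apply/seteqP; split=> [x Cx|x [/interior_subset[]//]].
split; last exact: CB.
apply: filterS (Cnear x Cx) => y CBy.
by have [/CBy|] := pselect (B y); [left|right].
Qed.

Lemma strictly_convex_segment x y (t : R) : strictly_convex X ->
  unit_ball X x -> unit_ball X y -> x != y -> 0 < t < 1 ->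
  `|t *: x + (1 - t) *: y| < 1.
Proof.
move=> sc xB yB xy t01; have /andP[t0 t1] := t01.
rewrite lt_neqAle; apply/andP; split; last exact: unit_ball_segment.
apply/eqP => n1; have [_ /(_ x y t xB yB t0 t1 erefl)[xe ye]] := sc _ n1.
by move: xy; rewrite xe -ye eqxx.
Qed.

(** The point [x k] of the open ball has a whole neighbourhood in [S k], so that
    it can be moved in every direction; a displacement [y - z] of the combination
    is obtained by moving [x k] alone by [(l k)^-1 *: (y - z)]. *)
Lemma minkowski_comb_near n (l : 'I_n -> R) (S : 'I_n -> set X)
    (x : 'I_n -> X) k :
  (forall i, is_slice (S i)) -> (forall i, S i (x i)) ->
  0 < l k -> `|x k| < 1 ->
  \forall y \near \sum_(i < n) l i *: x i, minkowski_comb l S y.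
Proof.
move=> Ssl Sx lk0 xk1; set z := \sum_(i < n) _.
pose move_k y := x k + (l k)^-1 *: (y - z).
have move_kz : move_k y @[y --> z] --> x k.
  rewrite -[X in _ --> X]addr0 -(scaler0 _ (l k)^-1) -(subrr z).
  apply: cvgD; first exact: cvg_cst.
  by apply: cvgZr; apply: cvgB; [exact: cvg_id | exact: cvg_cst].
have norm_near : \forall u \near x k, `|u| < 1.
  exact: (cvgr_lt `|x k| (@norm_continuous _ _ (x k))).
have ball_near : \forall u \near x k, unit_ball X u.
  by apply: filterS norm_near => u /ltW.
have Sk_near : \forall u \near x k, S k u.
  by apply: filterS2 ball_near (is_slice_near (Ssl k) (Sx k)) => u uB; exact.
have move_kS : \forall y \near z, S k (move_k y) by exact: move_kz _ Sk_near.
apply: filterS move_kS => y Sky.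
exists (fun i => if i == k then move_k y else x i); split.
  by move=> i; case: eqP => [->|].
rewrite (bigD1 k)//= eqxx /move_k scalerDr scalerA mulfV ?gt_eqF// scale1r.
rewrite (eq_bigr (fun i => l i *: x i)) => [|i /negPf->//].
have zE : z = l k *: x k + \sum_(i < n | i != k) l i *: x i.
  by rewrite /z (bigD1 k).
by rewrite addrAC -zE addrC subrK.
Qed.

(** Contracting all the [x i] towards their barycenter [z] leaves the barycenter
    fixed and, the segment from [x k] to [z] being non-trivial, brings [x k] into
    the open ball by strict convexity. *)
Lemma minkowski_comb_shrink n (l : 'I_n -> R) (S : 'I_n -> set X)
    (x : 'I_n -> X) k : strictly_convex X ->
  (forall i, 0 <= l i) -> \sum_(i < n) l i = 1 ->
  (forall i, is_slice (S i)) -> (forall i, S i (x i)) ->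
  x k != \sum_(i < n) l i *: x i ->
  exists x' : 'I_n -> X, [/\ forall i, S i (x' i), `|x' k| < 1 &
    \sum_(i < n) l i *: x' i = \sum_(i < n) l i *: x i].
Proof.
move=> sc l0 l1 Ssl Sx; set z := \sum_(i < n) _ => xkz.
have xB i : unit_ball X (x i) by exact: is_slice_sub_ball (Sx i).
have zB : unit_ball X z by exact: unit_ball_comb.
pose x' (t : R) i := t *: z + (1 - t) *: x i.
have x'B t i : 0 < t < 1 -> unit_ball X (x' t i) by exact: unit_ball_segment.
have x'0 i : x' t i @[t --> 0^'+] --> x i.
  apply: cvg_at_right_filter.
  have -> : x i = 0 *: z + (1 - 0) *: x i by rewrite scale0r add0r subr0 scale1r.
  apply: cvgD; apply: cvgZl; first exact: cvg_id.
  by apply: cvgB; [exact: cvg_cst|exact: cvg_id].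
have near01 : \forall t \near (0 : R)^'+, 0 < t < 1.
  by near=> t; apply/andP; split; near: t;
    [exact: nbhs_right_gt | exact: nbhs_right_lt].
have nearS : \forall t \near (0 : R)^'+, forall i, S i (x' t i).
  apply: filter_forall => i.
  near=> t; have : unit_ball X (x' t i) by apply: x'B; near: t.
  by near: t; exact: x'0 _ (is_slice_near (Ssl i) (Sx i)).
have [t [t01 St]] := filter_ex (filterI near01 nearS).
exists (x' t); split=> //.
  by apply: strictly_convex_segment; rewrite // eq_sym.
rewrite /x' (eq_bigr (fun i => l i *: (t *: z) + (1 - t) *: (l i *: x i))).
  rewrite big_split/= -scaler_suml l1 scale1r -scaler_sumr -/z.
  by rewrite -scalerDl subrKC scale1r.
by move=> i _; rewrite scalerDr !scalerA [(1 - t) * _]mulrC.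
Unshelve. all: by end_near. Qed.

Lemma strictly_convex_N1 : strictly_convex X -> property_N1 X.
Proof.
move=> sc _ [n [l [S [l01 l1 Ssl ->]]]].
have l0 i : 0 <= l i by have /andP[] := l01 i.
apply: near_relatively_open.
  move=> _ [x [Sx ->]]; apply: unit_ball_comb => // i.
  exact: is_slice_sub_ball (Sx i).
move=> _ [x [Sx ->]]; set z := \sum_(i < n) _.
have [[k [lk0 xkz]]|all_z] := pselect (exists k, 0 < l k /\ x k != z).
  have [x' [Sx' x'k x'z]] := minkowski_comb_shrink sc l0 l1 Ssl Sx xkz.
  rewrite /z -x'z.
  by apply: filterS (minkowski_comb_near Ssl Sx' lk0 x'k) => y ? _.
have xz i : 0 < l i -> x i = z.
  move=> li0; apply/eqP/negPn/negP => xiz; apply: all_z.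
  by exists i.
have nearS : \forall y \near z, forall i, 0 < l i -> unit_ball X y -> S i y.
  apply: filter_forall => i; have [li0|_] := ltP 0 (l i); last exact: nearW.
  have Siz : S i z by rewrite -(xz i li0).
  by apply: filterS (is_slice_near (Ssl i) Siz) => y Siy _.
apply: filterS nearS => y Sy yB.
(* A slice of weight zero need not contain [y]; its point [x i] is kept. *)
exists (fun i => if 0 < l i then y else x i); split.
  by move=> i; case: ifPn => // /Sy; exact.
rewrite (eq_bigr (fun i => l i *: y)) => [|i _].
  by rewrite -scaler_suml l1 scale1r.
case: ifPn => // li; have -> : l i = 0; last by rewrite !scale0r.
by apply/eqP; rewrite eq_le l0 leNgt li.
Qed.

Lemma strictly_convex_not_CS : (exists x : X, x != 0) -> strictly_convex X ->
  ~ property_CS X.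
Proof.
move=> /dual_sphere_neq0[f f1] sc.
pose g (i : 'I_2) : {linear X -> R^o} := if i == ord0 then f else \- f.
pose C := minkowski_comb (fun=> 2^-1) (fun i => slice (g i) 1).
have CC : convex_comb_of_slices C.
  exists 2%N, (fun=> 2^-1), (fun i => slice (g i) 1); split=> //.
  - by move=> _; lra.
  - by rewrite sumr_const card_ord; lra.
  - move=> i; exists (g i), 1; split=> //.
    by rewrite /g; case: ifP => // _; exact: dual_sphereN.
move=> /(_ C CC)[y [[x [Sx yx]] y1]].
have h0 : 0 < 2^-1 :> R by lra.
have h1 : 2^-1 < 1 :> R by lra.
have ye : y = 2^-1 *: x ord0 + (1 - 2^-1) *: x ord_max.
  rewrite yx big_ord_recl big_ord1; congr (_ *: _ + _ *: x _); first lra.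
  exact/val_inj.
have [_ ext] := sc y y1.
have [x0 x1] := ext _ _ _ (Sx ord0).1 (Sx ord_max).1 h0 h1 ye.
have := (Sx ord0).2; have := (Sx ord_max).2; rewrite x0 x1 /g /= subrr.
by rewrite oppr_gt0 => /lt_trans/[apply]; rewrite ltxx.
Qed.

End Slices.

Theorem proposition2p3 (R : realType) (X : completeNormedModType R)
    (X_nonzero : exists x : X, x != 0) (X_sc : strictly_convex X) :
  property_N1 X /\ ~ property_CS X.
Proof.
split; first exact: strictly_convex_N1.
exact: strictly_convex_not_CS.
Qed.
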